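(* For every tournament $T$ with at least five vertices, $\delta(T) = \left\lceil \frac{\Delta(T)}{2} \right\rceil$.
   Context: A tournament $T$ is a finite vertex set $V(T)$ with an arc set $A(T)$ such that for all distinct $x,y$, exactly one of $(x,y),(y,x)$ lies in $A(T)$. A module of $T$ is a subset $M \subseteq V(T)$ such that for all $x,y \in M$ and $v \notin M$, $(v,x)\in A(T)$ iff $(v,y)\in A(T)$; the trivial modules are $\emptyset$, singletons and $V(T)$; $T$ is indecomposable if all its modules are trivial. For $B \subseteq A(T)$, ${\rm Inv}(T,B)$ is obtained from $T$ by reversing every arc of $B$. For $T$ with at least five vertices, $\delta(T)$ is the least $m$ such that some $B \subseteq A(T)$ with $|B|=m$ makes ${\rm Inv}(T,B)$ indecomposable. For $X \subseteq V(T)$ write $\overline{X} = V(T)\setminus X$. A co-module of $T$ is a subset $M$ such that $M$ or $\overline{M}$ is a nontrivial module of $T$; a co-modular decomposition is a set of pairwise disjoint co-modules; $\Delta(T)$ is the largest size of a co-modular decomposition of $T$. *)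

(* Defs.v *)
From mathcomp Require Import all_boot.

Set Implicit Arguments.
Unset Strict Implicit.
Unset Printing Implicit Defensive.

Section Tournament.

Variable V : finType.
Implicit Types (A B : {set V * V}) (M : {set V}) (D : {set {set V}}).

Definition tournament A : Prop :=
  (forall x, (x, x) \notin A) /\
  (forall x y, x != y -> ((x, y) \in A) (+) ((y, x) \in A)).

Definition is_module A M : bool :=
  [forall x in M, forall y in M, forall v in ~: M,
     ((v, x) \in A) == ((v, y) \in A)].

Definition trivial_set M : bool := [|| M == set0, #|M| == 1 | M == [set: V]].

Definition nontrivial_module A M : bool := is_module A M && ~~ trivial_set M.

Definition indecomposable A : bool :=
  [forall M : {set V}, is_module A M ==> trivial_set M].

Definition Inv A B : {set V * V} := (A :\: B) :|: [set (p.2, p.1) | p in B].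

(* [is_delta A m] reads "delta(A) exists and equals m", so that no default
   value is needed for the minimum. *)
Definition is_delta A (m : nat) : Prop :=
  (exists B, [/\ B \subset A, #|B| = m & indecomposable (Inv A B)]) /\
  (forall B, B \subset A -> indecomposable (Inv A B) -> m <= #|B|).

Definition comodule A M : bool :=
  nontrivial_module A M || nontrivial_module A (~: M).

Definition comodular_decomposition A D : bool :=
  [forall M in D, comodule A M] && trivIset D.

(* The maximum is over a nonempty family, as [set0] is a decomposition. *)
Definition Delta A : nat :=
  \max_(D : {set {set V}} | comodular_decomposition A D) #|D|.

End Tournament.

(* Main.v *)
Require Import Defs.
From mathcomp Require Import all_boot.

(* Lower bound: every comodule must be crossed by a reversed arc, and an arc
   crosses at most two members of a family of disjoint comodules.

   Upper bound: one arc reversal lowers [uphalf Delta].  Two distinct minimal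
   comodules meet only as modules [{a, b}] and [{b, c}], so these overlaps form
   paths and a greedy choice yields a packing [D] of [Delta] minimal comodules
   together with one point [f X] in each [X \in D] such that every comodule
   contains one of these points.  The arc between [f X] and [f Y] is reversed for
   a pair [X], [Y] such that no comodule meets the chosen points exactly in
   [{f X, f Y}]; the remaining [Delta - 2] points then hit every comodule that is
   not crossed by the arc.  Such a pair exists by a count on four points, except
   when [Delta = 3], where losing one comodule is enough.  Up to moving an
   endpoint inside [X] or [Y], the reversal creates no new module: a new module
   would make [X :|: Y] a module, or [~: X :\ f Y] if [X] is not a module. *)

Set Implicit Arguments.
Unset Strict Implicit.
Unset Printing Implicit Defensive.

(** * Modules and comodules of a tournament *)

Section Modules.

Variables (V : finType) (A : {set V * V}).
Hypothesis hA : tournament A.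
Implicit Types (s v w x y z : V) (M N P Q X Y Z : {set V}).

Lemma arcC x y : x != y -> ((x, y) \in A) = ~~ ((y, x) \in A).
Proof. by move/(hA.2 x y); do 2!case: (_ \in A). Qed.

Lemma moduleP M :
  reflect (forall v x y, v \notin M -> x \in M -> y \in M ->
             ((v, x) \in A) = ((v, y) \in A))
          (is_module A M).
Proof.
apply: (iffP forall_inP) => [H v x y vM xM yM | H x xM].
  move: (H x xM) => /forall_inP/(_ y yM)/forall_inP/(_ v).
  by rewrite inE vM => /(_ isT)/eqP.
apply/forall_inP=> y yM; apply/forall_inP=> v; rewrite inE => vM.
by apply/eqP; apply: H.
Qed.

Lemma module_arc M v x y : is_module A M -> v \notin M -> x \in M -> y \in M ->
  ((v, x) \in A) = ((v, y) \in A).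
Proof. by move/moduleP; apply. Qed.

Lemma notin_neq M v x : v \notin M -> x \in M -> v != x.
Proof. by move=> vM xM; apply: contraNneq vM => ->. Qed.

Lemma module_arcr M v x y : is_module A M -> v \notin M -> x \in M -> y \in M ->
  ((x, v) \in A) = ((y, v) \in A).
Proof.
move=> mM vM xM yM.
by rewrite !(@arcC _ v) 1?eq_sym ?(notin_neq vM) // (module_arc mM vM xM yM).
Qed.

Lemma module_setI P Q : is_module A P -> is_module A Q -> is_module A (P :&: Q).
Proof.
move=> mP mQ; apply/moduleP=> v x y; rewrite !inE negb_and.
move=> /orP[vP|vQ] /andP[xP xQ] /andP[yP yQ]; first exact: (module_arc mP).
exact: (module_arc mQ).
Qed.

Lemma module_setU P Q z : is_module A P -> is_module A Q ->
  z \in P -> z \in Q -> is_module A (P :|: Q).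
Proof.
move=> mP mQ zP zQ; apply/moduleP=> v x y; rewrite !inE negb_or.
have to_z t : t \in P :|: Q -> v \notin P -> v \notin Q ->
    ((v, t) \in A) = ((v, z) \in A).
  by rewrite inE => /orP[tP|tQ] vP vQ; [apply: (module_arc mP)|apply: (module_arc mQ)].
by move=> /andP[vP vQ] xPQ yPQ; rewrite !to_z // inE.
Qed.

(** A vertex [v] of [P :&: Q] is compared with [t]: vertices of [P :\: Q] lie outside [Q], so each
    sees [v] and [t] alike (arcs in the same direction), and [t], outside [P], sees all of [P]
    alike. *)
Lemma module_setD P Q t : is_module A P -> is_module A Q ->
  t \in Q -> t \notin P -> is_module A (P :\: Q).
Proof.
move=> mP mQ tQ tP; apply/moduleP=> v x y; rewrite !inE negb_and negbK.
move=> vPQ /andP[xQ xP] /andP[yQ yP].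
case: (boolP (v \in P)) => [vP|vP]; last exact: (module_arc mP).
move: vPQ; rewrite vP orbF => vQ.
rewrite !(@arcC v) ?(eq_sym v) ?(notin_neq xQ) ?(notin_neq yQ) //.
rewrite (module_arc mQ xQ vQ tQ) (module_arc mQ yQ vQ tQ).
by rewrite (module_arcr mP tP xP yP).
Qed.

Lemma trivial_setN M : ~~ trivial_set M = (1 < #|M|) && (M != [set: V]).
Proof.
rewrite /trivial_set !negb_or -cards_eq0 andbA; congr (_ && _).
by case: #|M| => [|[|]].
Qed.

Lemma exists_other M x : 1 < #|M| -> exists2 z, z \in M & z != x.
Proof.
case/card_gt1P=> u [v [uM vM uv]]; case: (eqVneq u x) => [<-|]; last by exists u.
by exists v => //; rewrite eq_sym.
Qed.

Lemma card_gt1_other M x z : x \in M -> z \in M -> z != x -> 1 < #|M|.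
Proof. by move=> xM zM zx; apply/card_gt1P; exists z, x. Qed.

Lemma neq_setT M v : v \notin M -> M != [set: V].
Proof. by apply: contraNneq => ->; rewrite inE. Qed.

Lemma setTPn M : M != [set: V] -> exists v, v \notin M.
Proof.
move=> MT; apply/existsP; apply: contraR MT; rewrite negb_exists => /forallP H.
by apply/eqP/setP=> v; rewrite inE; apply/negPn.
Qed.

Lemma nontrivial_moduleE M :
  nontrivial_module A M = [&& is_module A M, 1 < #|M| & M != [set: V]].
Proof. by rewrite /nontrivial_module trivial_setN. Qed.

Lemma comoduleC Z : comodule A (~: Z) = comodule A Z.
Proof. by rewrite /comodule setCK orbC. Qed.

Lemma comodule_neq0 Z : comodule A Z -> Z != set0.
Proof.
case/orP; rewrite nontrivial_moduleE => /and3P[_ ]; first by rewrite -cards_eq0; case: #|Z|.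
by move=> _; apply: contraNneq => ->; rewrite setC0.
Qed.

Lemma nontrivial_comodule M : nontrivial_module A M -> comodule A M.
Proof. by rewrite /comodule => ->. Qed.

Lemma nontrivial_comoduleC M : nontrivial_module A M -> comodule A (~: M).
Proof. by rewrite comoduleC; apply: nontrivial_comodule. Qed.

(** * Minimal comodules and their overlaps *)

Definition mincomodule X := minset (comodule A) X.

Lemma mincomodule_eq X Z : mincomodule X -> comodule A Z -> Z \subset X -> Z = X.
Proof. exact: minsetinf. Qed.

Lemma mincomodule_comodule X : mincomodule X -> comodule A X.
Proof. exact: minsetp. Qed.

(** With two elements, [Z] would be a nontrivial module, hence a comodule, and minimality would give
    [Z = X], against [t]. *)
Lemma module_in_mincomodule X Z z t : mincomodule X -> is_module A Z -> Z \subset X ->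
  z \in Z -> t \in X -> t \notin Z -> Z = [set z].
Proof.
move=> mX mZ ZX zZ tX tZ; apply/eqP; rewrite eqEsubset sub1set zZ andbT.
apply/subsetP=> u uZ; rewrite inE; apply: contraNT tZ => uz.
rewrite (mincomodule_eq mX _ ZX) //; apply: nontrivial_comodule.
rewrite nontrivial_moduleE mZ (card_gt1_other zZ uZ uz) /=.
apply: contraTneq (mincomodule_comodule mX) => ZT.
have ->: X = [set: V] by apply/eqP; rewrite -subTset -ZT.
by rewrite -comoduleC setCT; apply/negP => /comodule_neq0; rewrite eqxx.
Qed.

(** Source of smaller comodules: when [P] or [Q] is the complement of a minimal comodule, the set
    obtained lies inside that minimal one. *)
Lemma comodule_setU P Q t r : is_module A P -> is_module A Q ->
  1 < #|P| -> t \in P -> t \in Q -> r \notin P -> r \notin Q ->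
  comodule A (~: (P :|: Q)).
Proof.
move=> mP mQ gtP tP tQ rP rQ; apply: nontrivial_comoduleC.
rewrite nontrivial_moduleE (module_setU mP mQ tP tQ).
rewrite (leq_trans gtP) ?subset_leq_card ?subsetUl //=.
by apply: (@neq_setT _ r); rewrite inE negb_or rP.
Qed.

(** Neither set contains the other. If [X] were not a module, [~: X] would be one, and its union
    with whichever of [Y], [~: Y] is a module would have as complement a comodule strictly inside
    [X]. So both are modules, and [X :&: Y] and [X :\: Y] are proper submodules, hence points. *)
Lemma mincomodule_overlap X Y v : mincomodule X -> mincomodule Y -> X != Y ->
  v \in X -> v \in Y ->
  [/\ is_module A X, is_module A Y,
      exists2 x, x != v & X = [set v; x] & exists2 y, y != v & Y = [set v; y]].
Proof.
have sub Z Z' : mincomodule Z -> mincomodule Z' -> Z != Z' ->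
    exists2 t, t \in Z & t \notin Z'.
  move=> mZ mZ' ZZ'; apply/subsetPn; apply: contra ZZ' => ZZ'.
  by apply/eqP; apply: mincomodule_eq ZZ' => //; apply: mincomodule_comodule.
have mod Z Z' : mincomodule Z -> mincomodule Z' -> Z != Z' ->
    v \in Z -> v \in Z' -> is_module A Z.
  move=> minZ minZ' ZZ' vZ vZ'.
  have [z zZ zZ'] := sub _ _ minZ minZ' ZZ'.
  have [z' z'Z' z'Z] : exists2 t, t \in Z' & t \notin Z.
    by apply: sub; rewrite // eq_sym.
  (* If the union were everything, the comodule [~: Z] would lie in [Z'] and so equal it, yet [v] is
     in both [Z] and [Z']. *)
  have [s sU] : exists s, s \notin Z :|: Z'.
    apply: setTPn; apply/eqP => UT.
    suff /setP/(_ v) : ~: Z = Z' by rewrite inE vZ vZ'.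
    apply: (mincomodule_eq minZ').
      by rewrite comoduleC (mincomodule_comodule minZ).
    apply/subsetP=> u; rewrite inE => uZ; have : u \in Z :|: Z' by rewrite UT inE.
    by rewrite inE (negbTE uZ).
  move: sU; rewrite inE negb_or => /andP[sZ sZ'].
  case/orP: (mincomodule_comodule minZ); rewrite nontrivial_moduleE => /and3P[mZ gtZ _] //.
  case/orP: (mincomodule_comodule minZ'); rewrite nontrivial_moduleE => /and3P[mZ' gtZ' _].
    have com : comodule A (~: (~: Z :|: Z')).
      by apply: (@comodule_setU _ _ z' z); rewrite ?inE ?zZ ?z'Z.
    have comZ : ~: (~: Z :|: Z') \subset Z.
      by apply/subsetP=> u; rewrite !inE negb_or negbK => /andP[].
    have /setP/(_ v) := mincomodule_eq minZ com comZ.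
    by rewrite !inE vZ vZ' orbT.
  have com : comodule A (~: (~: Z :|: ~: Z')).
    by apply: (@comodule_setU _ _ s v); rewrite ?inE ?sZ ?sZ' ?vZ ?vZ'.
  have comZ : ~: (~: Z :|: ~: Z') \subset Z.
    by apply/subsetP=> u; rewrite !inE negb_or !negbK => /andP[].
  have /setP/(_ z) := mincomodule_eq minZ com comZ.
  by rewrite !inE zZ zZ' orbT.
have pair Z Z' : mincomodule Z -> mincomodule Z' -> is_module A Z -> is_module A Z' ->
    Z != Z' -> v \in Z -> v \in Z' -> exists2 x, x != v & Z = [set v; x].
  move=> minZ minZ' mZ mZ' ZZ' vZ vZ'.
  have [x xZ xZ'] := sub _ _ minZ minZ' ZZ'.
  have [y yZ' yZ] : exists2 t, t \in Z' & t \notin Z.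
    by apply: sub; rewrite // eq_sym.
  have eI : Z :&: Z' = [set v].
    apply: (module_in_mincomodule minZ (module_setI mZ mZ') (subsetIl _ _) _ xZ).
      by rewrite inE vZ.
    by rewrite inE xZ.
  have eD : Z :\: Z' = [set x].
    apply: (module_in_mincomodule minZ (module_setD mZ mZ' yZ' yZ) (subsetDl _ _) _ vZ).
      by rewrite inE xZ' xZ.
    by rewrite inE vZ'.
  by exists x; [apply: notin_neq xZ' vZ' | rewrite -(setID Z Z') eI eD].
move=> minX minY XY vX vY; have YX : Y != X by rewrite eq_sym.
have mX := mod _ _ minX minY XY vX vY.
have mY := mod _ _ minY minX YX vY vX.
by split=> //; [apply: pair minX minY mX mY XY vX vY | apply: pair minY minX mY mX YX vY vX].
Qed.

(** * Scores and the greedy choice *)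

Definition score x := #|[set w | (x, w) \in A]|.

Lemma module2_score x y : x != y -> is_module A [set x; y] -> (y, x) \in A ->
  score x < score y.
Proof.
move=> xy mxy yx; apply: proper_card; apply/properP; split.
  apply/subsetP=> w; rewrite !inE => xw.
  have [wx|wx] := eqVneq w x; first by rewrite wx.
  have [wy|wy] := eqVneq w y; first by move: xw; rewrite wy arcC // yx.
  by rewrite -(@module_arcr _ w x y mxy) ?inE ?eqxx ?orbT // negb_or wx.
by exists x; rewrite inE // (negbTE (hA.1 x)).
Qed.

(** Take [a] of maximal score in the union of [F], in a member [X]. If [X] overlaps another member
    then [X = [set a; b]], and maximality with [module2_score] orients two-point members through [a]
    away from [a]. Two such members contradict each other, so every member meeting [X] contains
    [b]. *)
Lemma mincomodule_greedy (F : {set {set V}}) :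
  (forall X, X \in F -> mincomodule X) -> F != set0 ->
  exists X r, [/\ X \in F, r \in X & forall Y v, Y \in F -> v \in X -> v \in Y -> r \in Y].
Proof.
move=> minF /set0Pn[X0 X0F].
have /set0Pn[x0 x0X0] := comodule_neq0 (mincomodule_comodule (minF _ X0F)).
pose Pr (p : {set V} * V) := (p.1 \in F) && (p.2 \in p.1).
have Pr0 : Pr (X0, x0) by rewrite /Pr /= X0F.
case: (@arg_maxnP _ (X0, x0) Pr (fun p => score p.2) Pr0) => -[X a] /andP[/= XF aX] amax.
case: (pickP [pred Y | [&& Y \in F, X != Y & ~~ [disjoint X & Y]]]) => [Y|iso]; last first.
  exists X, a; split=> // Y v YF vX vY.
  have /= := iso Y; rewrite YF /=; have [<- //|_ /negbFE] := eqVneq X Y.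
  by move/disjointFr => /(_ v vX); rewrite vY.
case/and3P=> YF XY /pred0Pn[v /andP[/= vX vY]].
have [mX _ [x xv eX] _] := mincomodule_overlap (minF X XF) (minF Y YF) XY vX vY.
have [b ba eXab] : exists2 b, b != a & X = [set a; b].
  move: aX; rewrite eX !inE => /orP[/eqP->|/eqP->]; first by exists x.
  by exists v; rewrite 1?eq_sym // setUC.
have bX : b \in X by rewrite eXab !inE eqxx orbT.
have ab : (a, b) \in A.
  rewrite arcC 1?eq_sym //; apply/negP => bA.
  have : score b <= score a by apply: (amax (X, b)); rewrite /Pr /= XF.
  by rewrite leqNgt module2_score // -?eXab // eq_sym.
exists X, b; split=> // Z u ZF uX uZ.
have [->//|XZ] := eqVneq Z X; rewrite eq_sym in XZ.
move: uX uZ; rewrite eXab !inE => /orP[/eqP-> aZ|/eqP-> //].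
have [_ mZ _ [c ca eZ]] := mincomodule_overlap (minF X XF) (minF Z ZF) XZ aX aZ.
have cZ : c \in Z by rewrite eZ !inE eqxx orbT.
have [-> //|cb] := eqVneq b c.
have ac : (a, c) \in A.
  rewrite arcC 1?eq_sym //; apply/negP => cA.
  have : score c <= score a by apply: (amax (Z, c)); rewrite /Pr /= ZF.
  by rewrite leqNgt module2_score // -?eZ // eq_sym.
have bZ : b \notin Z by rewrite eZ !inE negb_or ba.
have cX : c \notin X by rewrite eXab !inE negb_or ca eq_sym.
(* Since [a] beats [b], the module [Z] makes [c] beat [b]; since [a] beats [c], the module [X] makes
   [b] beat [c]. *)
have := module_arcr mZ bZ aZ cZ; have := module_arcr mX cX aX bX.
by rewrite ab ac (arcC cb); case: (_ \in A).
Qed.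

End Modules.

(** * Packings with a transversal *)

Section Transversal.

Variable V : finType.
Implicit Types (X Y Z : {set V}) (D F : {set {set V}}).

(** Keep [X], discard the members containing [r], and recurse. Discarded members are hit by [r]; the
    others are disjoint from [X], because every member meeting [X] contains [r]. *)
Lemma greedy_transversal F (x0 : V) :
  (forall F', F' \subset F -> F' != set0 -> exists X (r : V),
     [/\ X \in F', r \in X & forall Y v, Y \in F' -> v \in X -> v \in Y -> r \in Y]) ->
  exists D (f : {set V} -> V),
    [/\ D \subset F, trivIset D, forall X, X \in D -> f X \in X &
        forall Y, Y \in F -> exists2 X, X \in D & f X \in Y].
Proof.
have [n] := ubnP #|F|; elim: n F => // n IHn F; rewrite ltnS => leF greedy.
have [->|F0] := eqVneq F set0.
  by exists set0, (fun=> x0); split=> [||X|X]; rewrite ?inE // /trivIset /cover !big_set0 cards0.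
have [X [r [XF rX Xr]]] := greedy F (subxx F) F0.
pose F' := [set Y in F | r \notin Y].
have sF'F : F' \subset F by apply/subsetP=> Y; rewrite inE => /andP[].
have [||D [f [sDF' tiD fD hitD]]] := IHn F'.
- apply: leq_trans leF; apply: proper_card; apply/properP; split=> //.
  by exists X => //; rewrite inE rX andbF.
- by move=> F'' sF'' ; apply: greedy; apply: subset_trans sF'F.
have rD Y : Y \in D -> (Y \in F) /\ (r \notin Y).
  by move/(subsetP sDF'); rewrite inE => /andP.
have dXD Y : Y \in D -> [disjoint X & Y].
  case/rD=> YF rY; apply/pred0P=> v /=; apply: contraNF rY => /andP[vX vY].
  exact: Xr YF vX vY.
have XD Y : Y \in D -> (Y == X) = false.
  by case/rD=> _; apply: contraNF => /eqP->.
exists (X |: D), (fun Z => if Z == X then r else f Z); split.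
- by apply/subsetP=> Y /setU1P[->//|/rD[]].
- apply/trivIsetP=> Y Z /setU1P[->|YD] /setU1P[->|ZD]; rewrite ?eqxx //.
  + by move=> _; apply: dXD.
  + by move=> _; rewrite disjoint_sym; apply: dXD.
  + by move/trivIsetP: tiD; apply.
- by move=> Y /setU1P[->|YD]; rewrite ?eqxx // XD //; apply: fD.
move=> Y YF; case: (boolP (r \in Y)) => rY.
  by exists X; rewrite ?eqxx ?setU11.
have [|Z ZD fZ] := hitD Y; first by rewrite inE YF.
by exists Z; rewrite ?XD // setU1r.
Qed.

(** Members of [D] are disjoint, so picking a point of [R] in each is injective. *)
Lemma packing_leq D (R : {set V}) : trivIset D ->
  (forall Z, Z \in D -> exists2 r, r \in R & r \in Z) -> #|D| <= #|R|.
Proof.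
move=> /trivIsetP tiD hit.
have [->|/set0Pn[Z0 Z0D]] := eqVneq D set0; first by rewrite cards0.
have [r0 _ _] := hit Z0 Z0D.
pose g Z := odflt r0 [pick r in R :&: Z].
have gP Z : Z \in D -> g Z \in R :&: Z.
  rewrite /g => /hit[r rR rZ]; case: pickP => [//|/(_ r)].
  by rewrite inE rR rZ.
rewrite -(@card_in_imset _ _ g).
  apply/subset_leq_card/subsetP=> _ /imsetP[Z ZD ->].
  by case/setIP: (gP Z ZD).
move=> Y Z YD ZD eg; apply/eqP; apply: contraT => YZ.
have := disjointFr (tiD Y Z YD ZD YZ).
move/(_ (g Y)); case/setIP: (gP Y YD) => _ -> /(_ isT).
by rewrite eg; case/setIP: (gP Z ZD) => _ ->.
Qed.

Lemma leq_Delta (A : {set V * V}) D : comodular_decomposition A D -> #|D| <= Delta A.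
Proof. by move=> cD; rewrite /Delta (leq_bigmax_cond (P := comodular_decomposition A)). Qed.

Lemma Delta_leq (A : {set V * V}) (R : {set V}) :
  (forall Z, comodule A Z -> exists2 r, r \in R & r \in Z) -> Delta A <= #|R|.
Proof.
move=> hit; apply/bigmax_leqP=> D /andP[/forall_inP cD tiD].
by apply: packing_leq => // Z /cD/hit.
Qed.

End Transversal.

(** [D] is a decomposition, so [#|D| <= Delta A]; its chosen points hit every minimal comodule,
    hence every comodule, which gives the converse. *)
Lemma mincomodule_transversal (V : finType) (A : {set V * V}) :
  tournament A -> 0 < #|V| ->
  exists (D : {set {set V}}) (f : {set V} -> V),
    [/\ forall X, X \in D -> mincomodule A X, trivIset D, #|D| = Delta A,
        forall X, X \in D -> f X \in X &
        forall Z, comodule A Z -> exists2 X, X \in D & f X \in Z].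
Proof.
move=> hA /card_gt0P[x0 _].
have [F' sF' F'0|D [f [sDF tiD fD hitD]]] :=
  @greedy_transversal V [set X | mincomodule A X] x0.
  by apply: (mincomodule_greedy hA) => // X /(subsetP sF'); rewrite inE.
have minD X : X \in D -> mincomodule A X by move/(subsetP sDF); rewrite inE.
have hit Z : comodule A Z -> exists2 X, X \in D & f X \in Z.
  move=> cZ; have [Y minY sYZ] := minset_exists cZ.
  have [|X XD fY] := hitD Y; first by rewrite inE.
  by exists X => //; apply: (subsetP sYZ).
exists D, f; split=> //; apply/eqP; rewrite eqn_leq leq_Delta /=.
  apply: leq_trans (leq_imset_card f D); apply: Delta_leq => Z /hit[X XD fX].
  by exists (f X); rewrite ?imset_f.
by rewrite /comodular_decomposition tiD andbT; apply/forall_inP=> X /minD/minsetp.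
Qed.

(** * Reversing a single arc *)

Definition flip (V : finType) (A : {set V * V}) (x y : V) : {set V * V} :=
  [set p | (p \in A) (+) ((p == (x, y)) || (p == (y, x)))].

(* The traces left in [A] by a module of [flip A x y] separating [x] from [y]. *)
Definition splits (V : finType) (A : {set V * V}) (x y : V) (M : {set V}) :=
  [/\ x \in M, y \notin M,
      forall z, z \in M -> z != x -> ((y, z) \in A) = ((x, y) \in A) &
      forall v u w, v \notin M -> v != y -> u \in M -> w \in M ->
        ((v, u) \in A) = ((v, w) \in A)].

(** A set that does not separate [x] from [y] is a module after the reversal exactly when it was one
    before. So a tame reversal creates no nontrivial module and destroys those that separate. *)
Definition tame (V : finType) (A : {set V * V}) (x y : V) :=
  forall M : {set V}, nontrivial_module (flip A x y) M -> (x \in M) = (y \in M).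

Section Flip.

Variables (V : finType) (A : {set V * V}).
Hypothesis hA : tournament A.
Implicit Types (s t u v w x y z : V) (M N P Q X Y Z : {set V}).

Lemma flipC x y : flip A x y = flip A y x.
Proof. by apply/setP=> p; rewrite !inE orbC. Qed.

Lemma flip_tournament x y : x != y -> tournament (flip A x y).
Proof.
move=> xy; split=> [z | u v uv]; rewrite !inE !xpair_eqE.
  rewrite (negbTE (hA.1 z)) /=; apply: contra xy.
  by case/orP=> /andP[/eqP-> /eqP->].
rewrite [(v == x) && _]andbC [(v == y) && _]andbC [_ && _ || (u == x) && _]orbC.
have := hA.2 u v uv.
by case: ((u, v) \in A); case: ((v, u) \in A); case: (_ || _).
Qed.

Lemma card_flip x y : x != y -> #|A :\: flip A x y| <= 1.
Proof.
move=> xy; rewrite -(cards1 (if (x, y) \in A then (x, y) else (y, x))).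
apply/subset_leq_card/subsetP=> p; rewrite !inE; case: ifP => xyA.
  have yxA : (y, x) \in A = false by rewrite (arcC hA) 1?eq_sym // xyA.
  case: (eqVneq p (x, y)) => // _; case: (eqVneq p (y, x)) => [->|_].
    by rewrite yxA.
  by case: (p \in A).
case: (eqVneq p (x, y)) => [->|_]; first by rewrite xyA.
by case: (p == _); case: (p \in A).
Qed.

Lemma flip_splits x y M : x != y -> is_module (flip A x y) M ->
  x \in M -> y \notin M -> splits A x y M.
Proof.
move=> xy /moduleP mM xM yM; split=> // [z zM zx|v u w vM vy uM wM].
  have := mM y z x yM zM xM; rewrite !inE !xpair_eqE !eqxx (negbTE zx).
  rewrite (negbTE (notin_neq yM xM)) /= addbT addbF => yz.
  by rewrite (arcC hA xy) -yz.
have := mM v u w vM uM wM; rewrite !inE !xpair_eqE.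
by rewrite (negbTE vy) (negbTE (notin_neq vM xM)) /= !addbF.
Qed.

Lemma tame_splits x y : x != y ->
  (forall M, 1 < #|M| -> ~ splits A x y M) ->
  (forall M, 1 < #|M| -> ~ splits A y x M) -> tame A x y.
Proof.
move=> xy nxy nyx M; rewrite nontrivial_moduleE => /and3P[mM gtM _].
case: (boolP (x \in M)) => xM; case: (boolP (y \in M)) => yM //.
  by case: (nxy M gtM); apply: flip_splits.
by case: (nyx M gtM); apply: flip_splits; rewrite // 1?eq_sym // flipC.
Qed.

Lemma tame_module x y M : tame A x y ->
  nontrivial_module (flip A x y) M -> nontrivial_module A M.
Proof.
move=> txy ntM; have xyM := txy M ntM; move: ntM.
rewrite !nontrivial_moduleE => /andP[mM ->]; rewrite andbT.
apply/moduleP=> v u w vM uM wM.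
have := module_arc mM vM uM wM.
have keep t : t \in M -> ((v, t) \in flip A x y) = ((v, t) \in A).
  move=> tM; rewrite inE !xpair_eqE.
  have -> : (v == x) && (t == y) = false.
    by apply: contraNF vM => /andP[/eqP-> /eqP ty]; rewrite xyM -ty.
  have -> : (v == y) && (t == x) = false.
    by apply: contraNF vM => /andP[/eqP-> /eqP tx]; rewrite -xyM -tx.
  by rewrite addbF.
by rewrite !keep.
Qed.

Lemma tame_comodule x y Z : tame A x y -> comodule (flip A x y) Z ->
  comodule A Z /\ (x \in Z) = (y \in Z).
Proof.
move=> txy /orP[] ntZ; split.
- by rewrite /comodule (tame_module txy ntZ).
- exact: txy.
- by rewrite /comodule (tame_module txy ntZ) orbT.
- by have := txy _ ntZ; rewrite !inE => /negb_inj.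
Qed.

(** As [y] sees all of [X] alike, [M] meets [X] only in [x]; it also meets [Y], in [z] say. A vertex
    outside [M] and [Y] sees [x] as it sees [z], hence as it sees [y]. For a vertex of [M] outside
    [X :|: Y] the comparison goes through another vertex of [X]. *)
Lemma splits_modules X Y x y M : is_module A X -> is_module A Y ->
  1 < #|X| -> 1 < #|Y| -> [disjoint X & Y] -> x \in X -> y \in Y ->
  1 < #|M| -> splits A x y M ->
  is_module A (X :|: Y) /\ is_module A (x |: Y).
Proof.
move=> mX mY gtX gtY dXY xX yY gtM [xM yM M1 M2].
have inXY v : v \in X -> v \notin Y by move=> vX; rewrite (disjointFr dXY).
have inYX v : v \in Y -> v \notin X by move=> vY; rewrite (disjointFl dXY).
have xy := notin_neq (inXY _ xX) yY.
have MX w : w \in X -> w != x -> w \notin M.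
  move=> wX wx; apply/negP => wM; have := M1 w wM wx.
  by rewrite (module_arc mX (inYX y yY) wX xX) (arcC hA xy); case: (_ \in A).
have [z zM zY] : exists2 z, z \in M & z \in Y.
  have [z zM zx] := exists_other x gtM.
  case: (boolP (z \in Y)) => zY; first by exists z.
  have [w wY wy] := exists_other y gtY.
  case: (boolP (w \in M)) => wM; first by exists w.
  have := M2 w z x wM wy zM xM.
  rewrite (module_arcr hA mY zY wY yY) (module_arcr hA mY (inXY x xX) wY yY).
  by rewrite (M1 z zM zx) (arcC hA xy); case: (_ \in A).
have Xx w : w \in X -> w != x -> ((w, x) \in A) = ((x, y) \in A).
  move=> wX wx; rewrite (M2 w x z) ?MX ?(notin_neq (inXY _ wX) yY) //.
  rewrite (module_arc mY (inXY _ wX) zY yY).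
  by rewrite (module_arcr hA mX (inYX _ yY) wX xX).
have outXY s : s \notin X -> s \notin Y -> ((s, x) \in A) = ((s, y) \in A).
  move=> sX sY; case: (boolP (s \in M)) => sM; last first.
    by rewrite (M2 s x z) ?(notin_neq sY yY) // (module_arc mY sY zY yY).
  have [w wX wx] := exists_other x gtX.
  have wM := MX w wX wx; have ws : w != s by rewrite eq_sym (notin_neq sX wX).
  rewrite (module_arc mX sX xX wX) !(arcC hA (x := s)) 1?eq_sym //; last first.
    by rewrite eq_sym (notin_neq sY yY).
  rewrite (M1 s sM (notin_neq sX xX)).
  by rewrite (M2 w s x wM _ sM xM) ?Xx // (notin_neq (inXY _ wX) yY).
have toy s t : s \notin X -> s \notin Y -> t \in X :|: Y ->
    ((s, t) \in A) = ((s, y) \in A).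
  move=> sX sY; rewrite inE => /orP[tX|tY]; last exact: (module_arc mY).
  by rewrite (module_arc mX sX tX xX) outXY.
split; apply/moduleP=> v p q.
  by rewrite {1}inE negb_or => /andP[vX vY] pXY qXY; rewrite !toy.
rewrite !inE negb_or => /andP[vx vY].
suff {p q}H p : (p == x) || (p \in Y) -> ((v, p) \in A) = ((v, y) \in A).
  by move=> /H-> /H->.
move=> pxY; case: (boolP (v \in X)) => vX; last first.
  by apply: toy; rewrite // inE; case/orP: pxY => [/eqP->|->]; rewrite ?xX ?orbT.
case/orP: pxY => [/eqP->|pY]; last exact: (module_arc mY).
by rewrite Xx // (module_arcr hA mX (inYX _ yY) vX xX).
Qed.

(** By [splits_modules] a new module would make [X :|: Y] a module, hence everything. The complement
    of [x |: Y] is then [X :\ x], a comodule strictly inside the minimal [X]; symmetrically for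
    [Y]. *)
Lemma tame_modules X Y x y : mincomodule A X -> mincomodule A Y ->
  nontrivial_module A X -> nontrivial_module A Y -> [disjoint X & Y] ->
  ~~ nontrivial_module A (X :|: Y) -> x \in X -> y \in Y -> tame A x y.
Proof.
move=> minX minY ntX ntY dXY ntXY xX yY.
move: ntX ntY; rewrite !nontrivial_moduleE => /and3P[mX gtX _] /and3P[mY gtY _].
have half X' Y' p q : mincomodule A X' -> is_module A X' -> is_module A Y' ->
    1 < #|X'| -> 1 < #|Y'| -> [disjoint X' & Y'] -> ~~ nontrivial_module A (X' :|: Y') ->
    p \in X' -> q \in Y' -> forall M, 1 < #|M| -> ~ splits A p q M.
  move=> minX' mX' mY' gtX' gtY' dXY' ntXY' pX qY M gtM sM.
  have [mU m1] := splits_modules mX' mY' gtX' gtY' dXY' pX qY gtM sM.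
  move: ntXY'; rewrite nontrivial_moduleE mU.
  rewrite (leq_trans gtX') ?subset_leq_card ?subsetUl //= negbK => /eqP UT.
  have [w wX wp] := exists_other p gtX'.
  have pU : p \in p |: Y' by rewrite setU11.
  have qp : q != p by rewrite eq_sym (notin_neq (negbT (disjointFr dXY' pX)) qY).
  have c1 : comodule A (~: (p |: Y')).
    apply: nontrivial_comoduleC; rewrite nontrivial_moduleE m1.
    rewrite (card_gt1_other pU _ qp) ?setU1r //=.
    by apply: (@neq_setT _ _ w); rewrite !inE negb_or wp (disjointFr dXY' wX).
  have s1 : ~: (p |: Y') \subset X'.
    apply/subsetP=> u; rewrite !inE negb_or => /andP[_ uY].
    have : u \in X' :|: Y' by rewrite UT inE.
    by rewrite inE (negbTE uY) orbF.
  by have /setP/(_ p) := mincomodule_eq minX' c1 s1; rewrite !inE eqxx pX.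
have xy : x != y by apply: (@notin_neq _ Y) => //; rewrite (disjointFr dXY).
apply: tame_splits => // M gtM; first by apply: (half X Y).
by apply: (half Y X); rewrite // 1?disjoint_sym // setUC.
Qed.

(** The hypothesis makes [y] a source or a sink, whereas [splits] wants it to see [x] and the rest
    of [M] in opposite directions. *)
Lemma end_not_splits x y M : is_module A (~: [set y]) -> x != y -> 1 < #|M| ->
  ~ splits A x y M.
Proof.
move=> my xy gtM [xM yM M1 _]; have [z zM zx] := exists_other x gtM.
have yz : z != y by rewrite eq_sym (notin_neq yM zM).
have := M1 z zM zx; rewrite (@module_arc _ A _ y z x my) ?inE ?eqxx //.
by rewrite (arcC hA xy); case: (_ \in A).
Qed.

Lemma tame_ends x y : is_module A (~: [set x]) -> is_module A (~: [set y]) ->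
  x != y -> tame A x y.
Proof.
by move=> mx my xy; apply: tame_splits => // M gtM; apply: end_not_splits; rewrite // eq_sym.
Qed.

(** All vertices see the source or sink [s] in one direction, so those outside [M] other than [y]
    see all of [M] that way. A vertex [u] outside [s |: Y] also sees [y] that way: directly if [u]
    is in [M], otherwise through a point of [M :&: Y], which must exist. *)
Lemma splits_end Y s y M : is_module A (~: [set s]) -> is_module A Y ->
  1 < #|Y| -> s \notin Y -> y \in Y -> 1 < #|M| -> splits A s y M ->
  is_module A (s |: Y) /\ forall v z, v \notin M -> v != y -> z \in M -> z != s ->
      ((v, z) \in A) = ((y, s) \in A).
Proof.
move=> ms mY gtY sY yY gtM [sM yM M1 M2].
have sy := notin_neq sY yY.
have sv v : v != s -> ((v, s) \in A) = ((y, s) \in A).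
  by move=> vs; apply: (module_arcr hA ms); rewrite ?inE ?eqxx // eq_sym.
have out v z : v \notin M -> v != y -> z \in M -> z != s ->
      ((v, z) \in A) = ((y, s) \in A).
  move=> vM vy zM zs; rewrite -(sv v) ?(notin_neq vM) //.
  exact: M2.
split=> //.
have uy u : u != s -> u \notin Y -> ((u, y) \in A) = ((y, s) \in A).
  move=> us uY; have uy := notin_neq uY yY.
  case: (boolP (u \in M)) => uM.
    by rewrite (arcC hA uy) (M1 u uM us) (arcC hA sy) negbK.
  case: (boolP [exists z, (z \in M) && (z \in Y)]) => [/existsP[z /andP[zM zY]]|].
    by rewrite (module_arc mY uY yY zY) out // eq_sym (notin_neq sY zY).
  rewrite negb_exists => /forallP MY.
  have [w wY wy] := exists_other y gtY; have [z zM zs] := exists_other s gtM.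
  have wM : w \notin M by have := MY w; rewrite wY andbT.
  have zY : z \notin Y by have := MY z; rewrite zM.
  have := out w z wM wy zM zs; rewrite (module_arcr hA mY zY wY yY) (M1 z zM zs).
  by rewrite (arcC hA sy); case: (_ \in A).
apply/moduleP=> u p q; rewrite !inE negb_or => /andP[us uY].
suff {p q}H p : (p == s) || (p \in Y) -> ((u, p) \in A) = ((y, s) \in A).
  by move=> /H-> /H->.
case/orP=> [/eqP->|pY]; first exact: sv.
by rewrite (module_arc mY uY pY yY) uy.
Qed.

End Flip.

(** * Tame arcs at a source or a sink *)

Section Ends.

Variables (V : finType) (A : {set V * V}).
Hypotheses (hA : tournament A) (hV : 5 <= #|V|).
Implicit Types (s t u v w x y z : V) (M N P Q X Y Z : {set V}).

Lemma tame_end Y s y : is_module A (~: [set s]) -> nontrivial_module A Y ->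
  s \notin Y -> ~~ nontrivial_module A (s |: Y) -> s |: Y != [set: V] ->
  y \in Y -> tame A s y.
Proof.
move=> ms ntY sY ntsY sYT yY.
move: ntY; rewrite nontrivial_moduleE => /and3P[mY gtY _].
have sy := notin_neq sY yY.
apply: tame_splits => // M gtM; last by apply: end_not_splits; rewrite // eq_sym.
case/(splits_end hA ms mY gtY sY yY gtM)=> msY _; case/negP: ntsY.
by rewrite nontrivial_moduleE msY sYT (leq_trans gtY) ?subset_leq_card ?subsetUr.
Qed.

(* If every [y] were the unique [b]-in-neighbour of some vertex of [Y], the
   [b]-arcs of [Y] would form a 3-cycle with nothing left around it. *)
Lemma exists_not_unique_inneighbor (b : bool) Y : 3 < #|Y| ->
  exists2 y, y \in Y & forall z, z \in Y -> z != y -> ((y, z) \in A) = b ->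
    exists w, [/\ w \in Y, w != y, w != z & ((w, z) \in A) = b].
Proof.
move=> gtY.
pose uniq_in y z := [&& z \in Y, z != y, ((y, z) \in A) == b &
  [forall w, [&& w \in Y, w != y & w != z] ==> (((w, z) \in A) == ~~ b)]].
case: (pickP [pred y in Y | [forall z, ~~ uniq_in y z]]) => [y /andP[/= yY /forallP Hy]|bad].
  exists y => // z zY zy yz; move: (Hy z); rewrite /uniq_in zY zy yz eqxx /=.
  rewrite negb_forall => /existsP[w]; rewrite negb_imply => /andP[/and3P[wY wy wz] wb].
  by exists w; split=> //; move: wb; case: (_ \in A); case: (b).
have uP y : y \in Y -> exists z, [/\ z \in Y, z != y, ((y, z) \in A) = b &
    forall w, w \in Y -> w != y -> w != z -> ((w, z) \in A) = ~~ b].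
  move=> yY; move: (bad y); rewrite /= yY /= => /negbT; rewrite negb_forall.
  case/existsP=> z; rewrite negbK => /and4P[zY zy /eqP yz /forallP Hz].
  by exists z; split=> // w wY wy wz; apply/eqP; have := Hz w; rewrite wY wy wz.
have opp u v : u != v -> ((u, v) \in A) = b -> ((v, u) \in A) = ~~ b.
  by move=> uv; rewrite (arcC hA uv) => <-; rewrite negbK.
have bN : b <> ~~ b by case: (b).
have /card_gt0P[y0 y0Y] : 0 < #|Y| by apply: leq_trans gtY.
have [y1 [y1Y y10 a01 u1]] := uP y0 y0Y.
have [y2 [y2Y y21 a12 u2]] := uP y1 y1Y.
have y20 : y2 != y0.
  by apply/eqP=> e; apply: bN; rewrite -{1}a12 e; apply: opp; rewrite // eq_sym.
have [y3 [y3Y y32 a23 u3]] := uP y2 y2Y.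
have y31 : y3 != y1.
  by apply/eqP=> e; apply: bN; rewrite -{1}a23 e; apply: opp; rewrite // eq_sym.
have e30 : y3 = y0.
  apply/eqP; apply: contraT => y30.
  have := u1 y3 y3Y y30 y31; rewrite (arcC hA y31) u3 1?eq_sym // negbK => e.
  by case: bN.
rewrite {}e30 in a23 u3 y31 y32 {y3Y}.
have [w wY wn] : exists2 w, w \in Y & w \notin [:: y0; y1; y2].
  apply/subsetPn; apply: contraTN gtY => /subset_leq_card le.
  by rewrite -leqNgt (leq_trans le) // card_size.
move: wn; rewrite !inE !negb_or => /and3P[w0 w1 w2].
have [z [zY zw awz uz]] := uP w wY.
have z0 : z != y0 by apply/eqP=> e; apply: bN; rewrite -{1}awz e u3.
have z1 : z != y1 by apply/eqP=> e; apply: bN; rewrite -{1}awz e u1.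
have z2 : z != y2 by apply/eqP=> e; apply: bN; rewrite -{1}awz e u2.
have := u3 z zY z2 z0; rewrite (arcC hA z0) uz 1?eq_sym // negbK => e.
by case: bN.
Qed.

(** Here [s |: Y] is everything, so its being a module is no contradiction. For a new module [M],
    [M :\ s] is a proper submodule of the minimal [Y], hence one point [z], and [y] is the only
    vertex of [Y] whose arc to [z] has the direction of the arcs from [s] to [Y]. The choice of [y]
    excludes this. *)
Lemma tame_end_full s : mincomodule A (~: [set s]) -> is_module A (~: [set s]) ->
  exists2 y, y != s & tame A s y.
Proof.
move=> minY mY; set Y := ~: [set s].
have inY v : (v \in Y) = (v != s) by rewrite !inE.
have cY : #|Y| = #|V|.-1 by rewrite cardsCs setCK cards1 subn1.
have gtY : 3 < #|Y| by rewrite cY -ltnS (ltn_predK hV).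
have /card_gt0P[y0 y0Y] : 0 < #|Y| by apply: leq_trans gtY.
have sNY : s \notin Y by rewrite inY eqxx.
have [y yY Hy] := @exists_not_unique_inneighbor ((s, y0) \in A) Y gtY.
have ys : y != s by rewrite -inY.
exists y => //; apply: tame_splits; rewrite 1?eq_sym // => M gtM; last first.
  exact: end_not_splits.
move=> sM; have gtY1 : 1 < #|Y| by apply: leq_trans gtY.
have [_ out] := splits_end hA mY mY gtY1 sNY yY gtM sM.
case: sM => sM yM M1 M2.
have esy v : v != s -> ((s, v) \in A) = ((s, y0) \in A).
  by move=> vs; apply: (module_arc mY); rewrite ?inE ?eqxx // -inY.
have eys : ((y, s) \in A) = ~~ ((s, y0) \in A) by rewrite (arcC hA ys) esy.
have [z zM zs] := exists_other s gtM.
have zy : z != y by rewrite eq_sym (notin_neq yM zM).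
have ayz : ((y, z) \in A) = ((s, y0) \in A) by rewrite M1 // esy.
have eM : M :\ s = [set z].
  apply: (@module_in_mincomodule _ A Y _ z y minY) => [||||]; last 4 first.
  - by apply/subsetP=> u; rewrite !inE => /andP[].
  - by rewrite !inE zs.
  - exact: yY.
  - by rewrite !inE negb_and yM orbT.
  apply/moduleP=> v p q; rewrite !inE negb_and negbK => vM /andP[ps pM] /andP[qs qM].
  have [->|vs] := eqVneq v s; first by rewrite !esy.
  rewrite (negbTE vs) /= in vM; have [->|vy] := eqVneq v y; first by rewrite !M1.
  by rewrite !out.
have [|w [wY wy wz awz]] := Hy z _ zy ayz; first by rewrite inY.
have wM : w \notin M.
  apply: contra wz => wM; suff: w \in M :\ s by rewrite eM inE.
  by rewrite !inE wM andbT -inY.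
by move: awz; rewrite out // eys; case: (_ \in A).
Qed.

(** * Tame arcs at a minimal comodule that is not a module *)

Section CoModule.

Variable X : {set V}.
Hypotheses (minX : mincomodule A X) (ntN : nontrivial_module A (~: X)).
Hypothesis nmX : ~~ is_module A X.

(** Put [N := ~: X]. If disjoint from [N], [P] would be [X] by minimality; if [P :|: N] were
    everything, [X = P :\: N] would be a module. Otherwise [~: (P :|: N)] is a comodule inside [X],
    hence [X] itself, and [P] misses [X]. *)
Lemma nontrivial_module_sub_setC P : nontrivial_module A P -> P \subset ~: X.
Proof.
move=> ntP; move: (ntP) (ntN); rewrite !nontrivial_moduleE.
case/and3P=> mP gtP PT /and3P[mN gtN NT].
case: (set_0Vmem (P :&: ~: X)) => [PN0|[z /setIP[zP zN]]].
  have PX : P \subset X by rewrite -(setCK X) -disjoints_subset -setI_eq0 PN0.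
  by case/negP: nmX; rewrite -(mincomodule_eq minX (nontrivial_comodule ntP) PX).
case: (eqVneq (P :|: ~: X) [set: V]) => [UT|/setTPn[r]].
  have [t tP] := setTPn PT.
  have tN : t \in ~: X.
    have : t \in P :|: ~: X by rewrite UT inE.
    by rewrite inE (negbTE tP).
  case/negP: nmX; suff <- : P :\: ~: X = X by apply: (module_setD hA mP mN tN tP).
  apply/setP=> u; rewrite !inE negbK; case: (boolP (u \in X)) => //= uX.
  have : u \in P :|: ~: X by rewrite UT inE.
  by rewrite !inE uX orbF.
rewrite inE negb_or => /andP[rP rN].
have cU := comodule_setU mP mN gtP zP zN rP rN.
have sU : ~: (P :|: ~: X) \subset X.
  by apply/subsetP=> u; rewrite !inE negb_or negbK => /andP[].
have /setP eU := mincomodule_eq minX cU sU.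
apply/subsetP=> u uP; rewrite inE; apply/negP => uX.
by have := eU u; rewrite !inE uP uX.
Qed.

Lemma comodule_mincomodule Z : comodule A Z -> (X \subset Z) || (Z \subset ~: X).
Proof.
case/orP=> /nontrivial_module_sub_setC; first by rewrite orbC => ->.
by rewrite setCS => ->.
Qed.

(** An endpoint of the reversed arc may thus be moved freely inside [X]. *)
Lemma comodule_eq_mem Z x x' : comodule A Z -> x \in X -> x' \in X -> (x \in Z) = (x' \in Z).
Proof.
move=> /comodule_mincomodule/orP[] /subsetP sZ xX x'X; first by rewrite !sZ.
by apply/idP/idP => /sZ; rewrite inE ?xX ?x'X.
Qed.

Variables (y y' : V).
Hypotheses (yX : y \notin X) (y'X : y' \notin X) (y'y : y' != y).
Let c := (y', y) \in A.
Let mN : is_module A (~: X). Proof. by move: ntN; rewrite nontrivial_moduleE => /andP[]. Qed.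

Let NE v z : v \notin X -> z \in X -> ((v, z) \in A) = ((y, z) \in A).
Proof. by move=> vX zX; apply: (module_arcr hA mN); rewrite !inE ?zX. Qed.

(** [M] is everything but [y]. It leaves [X], so [~: X :|: M] is a module; not lying in [~: X], it
    is everything, whence [X \subset M]. A vertex of [~: X] other than [y] outside [M] would see [X]
    as [y] does, against [splits]. *)
Lemma co_splits_in x M : x \in X -> 1 < #|M| -> splits A x y M ->
  (forall w, w \notin X -> w != y -> ((w, y) \in A) = c) /\
  [set z in X | ((y, z) \in A) == c] = [set x].
Proof.
move=> xX gtM [xM yM M1 M2].
have yx : y != x := notin_neq yX xX.
have [w wM wX] : exists2 w, w \in M & w \notin X.
  case: (boolP (y' \in M)) => y'M; first by exists y'.
  have [z zM zx] := exists_other x gtM.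
  case: (boolP (z \in X)) => zX; last by exists z.
  have := M2 y' z x y'M y'y zM xM; rewrite !NE // (M1 z zM zx) (arcC hA yx).
  by case: (_ \in A).
have XM : X \subset M.
  have : ~~ nontrivial_module A (~: X :|: M).
    apply/negP => /nontrivial_module_sub_setC/subsetP/(_ x).
    by rewrite !inE xM xX orbT => /(_ isT).
  rewrite nontrivial_moduleE.
  have -> : 1 < #|~: X :|: M| by rewrite (leq_trans gtM) // subset_leq_card ?subsetUr.
  have -> : is_module A (~: X :|: M).
    apply/moduleP=> u p q uU pU qU.
    move: uU; rewrite !inE negb_or negbK => /andP[uX uM].
    have uy : u != y by rewrite eq_sym (notin_neq yX uX).
    have H t : t \in ~: X :|: M -> ((u, t) \in A) = ((u, w) \in A).
      rewrite inE => /orP[tN|tM]; last exact: M2.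
      by apply: (module_arc mN) => //; rewrite inE ?uX.
    by rewrite !H.
  rewrite /= negbK => /eqP UT; apply/subsetP=> u uX.
  have : u \in ~: X :|: M by rewrite UT inE.
  by rewrite !inE uX.
have [z zX zx] : exists2 z, z \in X & z != x.
  apply: exists_other; rewrite ltnNge; apply: contra nmX.
  by move/card_le1_eqP=> eX; apply/moduleP=> v p q _ pX qX; rewrite (eX p q pX qX).
have NM v : v \notin X -> v != y -> v \in M.
  move=> vX vy; apply: contraT => vM.
  have := M2 v z x vM vy (subsetP XM _ zX) xM; rewrite !NE //.
  by rewrite (M1 z (subsetP XM _ zX) zx) (arcC hA yx); case: (_ \in A).
have src w' : w' \notin X -> w' != y -> ((w', y) \in A) = ~~ ((x, y) \in A).
  move=> w'X w'y; rewrite (arcC hA w'y) M1 ?NM //.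
  exact: notin_neq w'X xX.
have ec : c = ~~ ((x, y) \in A) by rewrite /c src.
split=> [w' w'X w'y|]; first by rewrite ec src.
apply/setP=> u; rewrite !inE; case: (eqVneq u x) => [->|ux].
  by rewrite xX (arcC hA yx) ec eqxx.
apply/negbTE/negP => /andP[uX]; rewrite (M1 u (subsetP XM _ uX) ux) ec.
by case: (_ \in A).
Qed.

(** As [x] sees [~: X] alike, [M :\ y] lies in [X]. It is a proper submodule of the minimal [X],
    hence one point [z], which the vertices of [X] other than [x] and [z] see as they see [y]. *)
Lemma co_splits_out x M : x \in X -> 1 < #|M| -> splits A y x M ->
  exists z, [/\ z \in X, z != x, ((y, z) \in A) = c, ((x, z) \in A) = ~~ ((x, y) \in A) &
    forall u, u \in X -> u != x -> u != z -> ((u, z) \in A) = ((u, y) \in A)].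
Proof.
move=> xX gtM [yM xM M1 M2].
have yx : y != x := notin_neq yX xX.
have xy : x != y by rewrite eq_sym.
have MX v : v \in M -> v != y -> v \in X.
  move=> vM vy; apply: contraT => vX; have := M1 v vM vy.
  rewrite (@module_arc _ A (~: X) x v y mN) ?inE ?xX // (arcC hA yx).
  by case: (_ \in A).
have y'M : y' \notin M by apply: contra y'X => y'M; apply: MX.
have [z zM zy] := exists_other y gtM; have zX := MX z zM zy.
have cM t : t \in M -> t != y -> ((y, t) \in A) = c.
  move=> tM ty; rewrite -(NE y'X (MX t tM ty)) /c.
  by apply: M2 => //; apply: notin_neq y'X xX.
have xt t : t \in M -> t != y -> ((x, t) \in A) = ~~ ((x, y) \in A).
  by move=> tM ty; rewrite M1 // (arcC hA yx).
have mMX : is_module A (M :\ y).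
  apply/moduleP=> v p q; rewrite !inE negb_and negbK => vM /andP[py pM] /andP[qy qM].
  have [->|vx] := eqVneq v x; first by rewrite (xt p) // (xt q).
  case: (boolP (v \in X)) => vX; last first.
    by rewrite (NE vX (MX p pM py)) (NE vX (MX q qM qy)) !cM.
  apply: M2 => //; case/orP: vM => // /eqP vy.
  by rewrite vy (negbTE yX) in vX.
have eM : M :\ y = [set z].
  apply: (module_in_mincomodule minX mMX _ _ xX).
  - by apply/subsetP=> u; rewrite !inE => /andP[uy uM]; apply: MX.
  - by rewrite !inE zy.
  - by rewrite !inE negb_and xM orbT.
exists z; split=> //; rewrite ?(cM z) ?(xt z) //; first by rewrite eq_sym (notin_neq xM zM).
move=> u uX ux uz; apply: M2 => //; apply: contra uz => uM.
suff: u \in M :\ y by rewrite eM inE.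
by rewrite !inE uM andbT eq_sym (notin_neq yX uX).
Qed.

Hypothesis ntNy : ~~ nontrivial_module A (~: X :\ y).

(** [bad_in] and [bad_out] are boolean forms of the conclusions of [co_splits_in] and
    [co_splits_out]; an [x] escaping both gives a tame arc. *)
Let bad_in x := ([set z in X | ((y, z) \in A) == c] == [set x]) &&
  [forall w, (w \notin X) && (w != y) ==> (((w, y) \in A) == c)].
Let bad_out x z := [&& z \in X, z != x, ((y, z) \in A) == c,
    ((x, z) \in A) != ((x, y) \in A) &
    [forall u, [&& u \in X, u != x & u != z] ==> (((u, z) \in A) == ((u, y) \in A))]].

(** Each [z] blocks at most one [x] through [bad_out]. If some [x0] is [bad_in], it is the only
    possible [z], so [X] has at most two points and [~: X :\ y] is a nontrivial module, which is
    excluded. If none is, each [x] has its own [z], so [y] sees all of [X] in direction [c] and [X]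
    is a module. *)
Lemma exists_not_bad : exists2 x, x \in X & ~~ bad_in x && [forall z, ~~ bad_out x z].
Proof.
case: (pickP [pred x in X | ~~ bad_in x && [forall z, ~~ bad_out x z]]) => [x /andP[/= xX Hx]|bad].
  by exists x.
have outP x : x \in X -> ~~ bad_in x -> exists z, bad_out x z.
  move=> xX nin; move: (bad x); rewrite /= xX nin /= => /negbT.
  by rewrite negb_forall => /existsP[z]; rewrite negbK; exists z.
have out_inj x x' z : x \in X -> x' \in X -> bad_out x z -> bad_out x' z -> x = x'.
  move=> xX x'X /and5P[_ _ _ _ /forallP/(_ x') Hx] /and5P[_ zx' _ x'z _].
  apply/eqP; apply: contraT => xx'; move: Hx.
  by rewrite x'X 1?eq_sym xx' 1?eq_sym zx' /= (negbTE x'z).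
case: (pickP [pred x in X | bad_in x]) => [x0 /andP[/= x0X in_x0]|nin].
  have [/eqP eNp /forallP sink] := andP in_x0.
  have out_x0 x : x \in X -> x != x0 -> bad_out x x0.
    move=> xX xx0; have [|z outz] := outP x xX.
      rewrite /bad_in eNp; apply: contra xx0 => /andP[/eqP/setP/(_ x)].
      by rewrite !inE eqxx => ->.
    case/and5P: (outz) => zX _ zc _ _.
    have : z \in [set z in X | ((y, z) \in A) == c] by rewrite inE zX.
    by rewrite eNp inE => /eqP ez; rewrite -ez.
  have cX : #|X| <= 2.
    rewrite (cardsD1 x0 X) x0X ltnS; apply/card_le1_eqP=> p q.
    rewrite !inE => /andP[px pX] /andP[qx qX].
    exact: (out_inj q p x0 qX pX (out_x0 q qX qx) (out_x0 p pX px)).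
  (* Five vertices enter here: two must remain in [~: X] once [y] is removed. *)
  have cN : 2 < #|~: X|.
    by rewrite -(ltn_add2l #|X|) cardsC; apply: leq_trans hV; rewrite addn2 !ltnS.
  case/negP: ntNy; rewrite nontrivial_moduleE; apply/and3P; split.
  - apply/moduleP=> v p q; rewrite !inE negb_and !negbK.
    move=> vX /andP[py pX] /andP[qy qX].
    have [->|vy] := eqVneq v y.
      have H t : t != y -> t \notin X -> ((y, t) \in A) = ~~ c.
        by move=> ty tX; have := sink t; rewrite tX ty (arcC hA ty) /= => /eqP<-; rewrite negbK.
      by rewrite !H.
    by apply: (module_arc mN); rewrite ?inE ?negbK //; move: vX; rewrite (negbTE vy).
  - by move: cN; rewrite (cardsD1 y) inE yX ltnS.
  - by apply: (@neq_setT _ _ y); rewrite !inE eqxx.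
pose f x := odflt x [pick z | bad_out x z].
have fP x : x \in X -> bad_out x (f x).
  move=> xX; rewrite /f; case: pickP => //= none.
  have [|z] := outP x xX; last by rewrite none.
  by move: (nin x); rewrite /= xX => /negbT.
case/negP: nmX; apply/moduleP=> v p q vX pX qX.
have Xc : [set z in X | ((y, z) \in A) == c] = X.
  apply/eqP; rewrite eqEcard; apply/andP; split.
    by apply/subsetP=> u; rewrite inE => /andP[].
  rewrite -(@card_in_imset _ _ f X).
    apply/subset_leq_card/subsetP=> _ /imsetP[x xX ->].
    by rewrite inE; case/and5P: (fP x xX) => -> _ -> _ _.
  move=> x x' xX x'X e; apply: (out_inj x x' (f x)) => //; first exact: fP.
  by rewrite e; apply: fP.
have toc t : t \in X -> ((v, t) \in A) = c.
  by move=> tX; rewrite NE //; apply/eqP; move: tX; rewrite -Xc inE => /andP[].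
by rewrite !toc.
Qed.

Lemma tame_comodule_point : exists2 x, x \in X & tame A x y.
Proof.
have [x xX /andP[nin /forallP nout]] := exists_not_bad.
exists x => //; apply: (tame_splits hA); first by rewrite eq_sym (notin_neq yX).
  move=> M gtM /(co_splits_in xX gtM)[sink eNp]; case/negP: nin.
  rewrite /bad_in eNp eqxx /=; apply/forallP=> w; apply/implyP=> /andP[wX wy].
  by rewrite sink.
move=> M gtM /(co_splits_out xX gtM)[z [zX zx yz xz Hz]].
case/negP: (nout z); rewrite /bad_out zX zx yz eqxx xz /=; apply/andP; split.
  by case: (_ \in A).
by apply/forallP=> u; apply/implyP=> /and3P[uX ux uz]; rewrite Hz.
Qed.

End CoModule.

End Ends.

(** * Resolving a pair of disjoint minimal comodules *)

Section Step.

Variables (V : finType) (A : {set V * V}).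
Hypotheses (hA : tournament A) (hV : 5 <= #|V|).
Implicit Types (p q s u v w x y z : V) (M N P Q W X Y Z : {set V}).

(** For a minimal comodule, the case left when it is neither a nontrivial module nor a single source
    or sink. *)
Definition cotype X := nontrivial_module A (~: X) && ~~ is_module A X.

Lemma mincomodule_cases X : mincomodule A X ->
  [\/ nontrivial_module A X, exists2 s, X = [set s] & is_module A (~: [set s]) | cotype X].
Proof.
move=> minX; have cX := mincomodule_comodule minX.
case/orP: (cX) => ntX; first by constructor 1.
case: (boolP (is_module A X)) => mX; last by constructor 3; rewrite /cotype ntX.
case: (boolP (nontrivial_module A X)) => [?|]; first by constructor 1.
rewrite nontrivial_moduleE mX /= negb_and negbK.
have XT : X != [set: V].
  apply: contraTneq ntX => ->; rewrite setCT nontrivial_moduleE cards0.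
  by rewrite andbF.
rewrite (negbTE XT) orbF -leqNgt leq_eqVlt ltnS leqn0 cards_eq0.
rewrite (negbTE (comodule_neq0 cX)) orbF => /cards1P[s eX].
by constructor 2; exists s => //; move: ntX; rewrite -eX => /andP[].
Qed.

(* Some reversal creates no new module and crosses at least the comodules that
   separate [x] from [y]. *)
Definition resolvable x y := exists p q, [/\ p != q, tame A p q &
  forall Z, comodule A Z -> (p \in Z) = (q \in Z) -> (x \in Z) = (y \in Z)].

Lemma resolvableC x y : resolvable x y -> resolvable y x.
Proof.
move=> [p [q [pq tpq H]]]; exists p, q; split=> // Z cZ e.
by rewrite (H Z cZ e).
Qed.

Lemma tame_resolvable x y : x != y -> tame A x y -> resolvable x y.
Proof. by move=> xy txy; exists x, y. Qed.

Lemma resolvable_cotype X x y : mincomodule A X -> cotype X -> x \in X -> y \notin X ->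
  ~~ nontrivial_module A (~: X :\ y) -> resolvable x y.
Proof.
move=> minX /andP[ntN nmX] xX yX ntNy.
have gtN : 1 < #|~: X| by move: ntN; rewrite nontrivial_moduleE => /and3P[].
have [y' y'N y'y] := exists_other y gtN; rewrite inE in y'N.
have [x' x'X tx'] := tame_comodule_point hA hV minX ntN nmX yX y'N y'y ntNy.
exists x', y; split=> //; first by rewrite eq_sym (notin_neq yX).
by move=> Z cZ <-; apply: (comodule_eq_mem hA minX ntN nmX).
Qed.

Lemma resolvable_end Y s y : mincomodule A Y -> nontrivial_module A Y ->
  is_module A (~: [set s]) -> s \notin Y -> ~~ nontrivial_module A (s |: Y) ->
  y \in Y -> resolvable s y.
Proof.
move=> minY ntY ms sY ntsY yY.
case: (eqVneq (s |: Y) [set: V]) => [sYT|sYT]; last first.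
  by apply: tame_resolvable; [apply: notin_neq yY | apply: (tame_end hA ms ntY)].
have eY : Y = ~: [set s].
  apply/setP=> u; rewrite !inE; have : u \in s |: Y by rewrite sYT inE.
  by rewrite !inE; have [->|_ /= ->//] := eqVneq u s; rewrite (negbTE sY).
have [|y' y's tsy'] := tame_end_full hA hV _ ms; first by rewrite -eY.
exists s, y'; split=> //; first by rewrite eq_sym.
have y'Y : y' \in Y by rewrite eY !inE.
(* No comodule has [s] and [y'] on the same side: it or its complement would lie in the minimal [Y],
   hence equal it, yet miss [y']. *)
move=> Z cZ; case: (boolP (s \in Z)) => sZ /esym y'Z.
  have ZY : ~: Z \subset Y.
    by rewrite eY setCS sub1set.
  rewrite -comoduleC in cZ.
  by have /setP/(_ y') := mincomodule_eq minY cZ ZY; rewrite inE y'Z y'Y.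
have ZY : Z \subset Y.
  by apply/subsetP=> u uZ; rewrite eY !inE; apply: contraNneq sZ => <-.
by have /setP/(_ y') := mincomodule_eq minY cZ ZY; rewrite y'Z y'Y.
Qed.

(** A [cotype] member settles the pair alone, whatever the other set is; the remaining combinations
    involve only nontrivial modules, sources and sinks. *)
Lemma mincomodule_resolvable X Y x y : mincomodule A X -> mincomodule A Y ->
  [disjoint X & Y] -> x \in X -> y \in Y -> ~~ nontrivial_module A (X :|: Y) ->
  (cotype X -> ~~ nontrivial_module A (~: X :\ y)) ->
  (cotype Y -> ~~ nontrivial_module A (~: Y :\ x)) -> resolvable x y.
Proof.
move=> minX minY dXY xX yY ntXY hX hY.
have xNY : x \notin Y by rewrite (disjointFr dXY).
have yNX : y \notin X by rewrite (disjointFl dXY).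
case: (mincomodule_cases minX) => [ntX|[s eX ms]|cX]; last first.
- exact: (resolvable_cotype minX cX xX yNX (hX cX)).
- move: xX; rewrite eX inE => /eqP ex; rewrite {}ex in hY xNY *.
  rewrite {}eX in ntXY.
  case: (mincomodule_cases minY) => [ntY|[t eY mt]|cY]; last first.
  + by apply/resolvableC/(resolvable_cotype minY cY yY xNY (hY cY)).
  + move: yY; rewrite eY inE => /eqP ->.
    have st : s != t by move: xNY; rewrite eY inE.
    by apply: tame_resolvable => //; apply: (tame_ends hA).
  + exact: (resolvable_end minY ntY ms).
case: (mincomodule_cases minY) => [ntY|[t eY mt]|cY]; last first.
- by apply/resolvableC/(resolvable_cotype minY cY yY xNY (hY cY)).
- move: yY; rewrite eY inE => /eqP ey; rewrite {}ey in yNX *.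
  apply: resolvableC; apply: (resolvable_end minX ntX mt) => //.
  by rewrite setUC -eY.
apply: tame_resolvable; first exact: notin_neq yY.
exact: (tame_modules hA minX minY).
Qed.

Lemma comodule_arcs Z x y u v : comodule A Z ->
  x \in Z -> y \in Z -> u \notin Z -> v \notin Z ->
  (((u, x) \in A) = ((u, y) \in A) /\ ((v, x) \in A) = ((v, y) \in A)) \/
  (((x, u) \in A) = ((x, v) \in A) /\ ((y, u) \in A) = ((y, v) \in A)).
Proof.
move=> /orP[] /andP[mZ _] xZ yZ uZ vZ; [left|right]; split;
  by apply: (module_arc mZ); rewrite ?inE ?negbK.
Qed.

(** On the four points, each comodule makes one half of its 2+2 split a module. One pair from each
    split gives a star or a triangle; two overlapping pairs put their common vertex between the
    other two, which cannot hold throughout. The proof checks all orientations of the six arcs. *)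
Lemma four_points x1 x2 x3 x4 Z12 Z13 Z23 :
  comodule A Z12 -> comodule A Z13 -> comodule A Z23 ->
  [/\ x1 \in Z12, x2 \in Z12, x3 \notin Z12 & x4 \notin Z12] ->
  [/\ x1 \in Z13, x2 \notin Z13, x3 \in Z13 & x4 \notin Z13] ->
  [/\ x1 \notin Z23, x2 \in Z23, x3 \in Z23 & x4 \notin Z23] -> False.
Proof.
move=> c12 c13 c23 [a1 a2 a3 a4] [b1 b2 b3 b4] [d1 d2 d3 d4].
have := comodule_arcs c12 a1 a2 a3 a4.
have := comodule_arcs c13 b1 b3 b2 b4.
have := comodule_arcs c23 d2 d3 d1 d4.
rewrite (arcC hA (notin_neq a3 a1)) (arcC hA (notin_neq a3 a2)).
rewrite (arcC hA (notin_neq b2 b1)) (arcC hA (notin_neq a4 a1)).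
rewrite (arcC hA (notin_neq a4 a2)) (arcC hA (notin_neq b4 b3)).
case: ((x1, x2) \in A); case: ((x1, x3) \in A); case: ((x2, x3) \in A);
case: ((x1, x4) \in A); case: ((x2, x4) \in A); case: ((x3, x4) \in A);
by case=> -[? ?]; case=> -[? ?]; case=> -[? ?].
Qed.

(** * Choosing the pair of packed comodules *)

Variables (D : {set {set V}}) (f : {set V} -> V).
Hypotheses (minD : forall X, X \in D -> mincomodule A X) (tiD : trivIset D).
Hypothesis fD : forall X, X \in D -> f X \in X.
Hypothesis hitD : forall Z, comodule A Z -> exists2 X, X \in D & f X \in Z.

Definition good_pair X Y := [forall Z, [&& comodule A Z, f X \in Z & f Y \in Z] ==>
  [exists W in D, [&& W != X, W != Y & f W \in Z]]].

Let dD X Y : X \in D -> Y \in D -> X != Y -> [disjoint X & Y].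
Proof. by move/trivIsetP: tiD; apply. Qed.

Let fND X Y : X \in D -> Y \in D -> X != Y -> f X \notin Y.
Proof. by move=> XD YD XY; rewrite (disjointFr (dD XD YD XY)) ?fD. Qed.

Lemma goodC X Y : good_pair X Y = good_pair Y X.
Proof.
apply: eq_forallb => Z; congr (_ ==> _).
  by rewrite [(f X \in Z) && _]andbC.
by apply: eq_existsb => W; rewrite [(W != X) && (_ && _)]andbCA.
Qed.

Lemma good_setU X Y : X \in D -> Y \in D -> X != Y -> good_pair X Y ->
  ~~ nontrivial_module A (X :|: Y).
Proof.
move=> XD YD XY /forallP/(_ (X :|: Y)) g; apply/negP => ntU.
move: g; rewrite (nontrivial_comodule ntU) !inE !fD // orbT /=.
case/existsP=> W /and4P[WD WX WY]; rewrite inE => /orP[]; apply/negP; exact: fND.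
Qed.

(** The complement of [~: X :\ f Y] is [f Y |: X], which meets the chosen points only in [f X] and
    [f Y]. *)
Lemma good_setC X Y : X \in D -> Y \in D -> X != Y -> good_pair X Y ->
  ~~ nontrivial_module A (~: X :\ f Y).
Proof.
move=> XD YD XY /forallP/(_ (~: (~: X :\ f Y))) g; apply/negP => ntU.
move: g; rewrite (nontrivial_comoduleC ntU) !inE !fD // eqxx andbF /=.
case/existsP=> W /and4P[WD WX WY]; rewrite !inE negb_and !negbK => /orP[/eqP e|].
  by have := fND WD YD WY; rewrite e fD.
by apply/negP/fND.
Qed.

Lemma exists_good_pair : #|D| != 3 -> 1 < #|D| ->
  exists X Y, [/\ X \in D, Y \in D, X != Y & good_pair X Y].
Proof.
move=> D3 gtD; case: (eqVneq #|D| 2) => [/eqP/cards2P[X [Y [XY eD]]]|D2].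
  exists X, Y; rewrite eD !inE !eqxx orbT; split=> //.
  (* A comodule containing both chosen points would have a complement containing none. *)
  apply/forallP=> Z; apply/implyP=> /and3P[cZ XZ YZ].
  have [W] : exists2 W, W \in D & f W \in ~: Z by apply: hitD; rewrite comoduleC.
  by rewrite eD !inE => /orP[]/eqP->; rewrite ?XZ ?YZ.
have {D2 D3 gtD} gt3 : 3 < #|D| by move: D2 D3 gtD; case: #|D| => [|[|[|[|]]]].
(* [f X4] is the point that all three comodules in [four_points] avoid. *)
have /card_gt0P[X4 X4D] : 0 < #|D| by apply: leq_trans gt3.
move: gt3; rewrite (cardsD1 X4) X4D ltnS => /card_gt2P[X1 [X2 [X3 [[]]]]].
rewrite !inE => /andP[n14 X1D] /andP[n24 X2D] /andP[n34 X3D] [n12 n23 n31].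
case: (boolP (good_pair X1 X2)) => g12; first by exists X1, X2.
case: (boolP (good_pair X1 X3)) => g13; first by exists X1, X3; rewrite eq_sym.
case: (boolP (good_pair X2 X3)) => g23; first by exists X2, X3.
have bad X Y : ~~ good_pair X Y -> exists Z, [/\ comodule A Z, f X \in Z, f Y \in Z &
    forall W, W \in D -> W != X -> W != Y -> f W \notin Z].
  rewrite negb_forall => /existsP[Z]; rewrite negb_imply => /andP[/and3P[cZ XZ YZ]].
  rewrite negb_exists => /forallP H; exists Z; split=> // W WD WX WY.
  by have := H W; rewrite WD WX WY.
have [Z12 [c12 a1 a2 a]] := bad _ _ g12.
have [Z13 [c13 b1 b3 b]] := bad _ _ g13.
have [Z23 [c23 d2 d3 d]] := bad _ _ g23.
case: (@four_points (f X1) (f X2) (f X3) (f X4) Z12 Z13 Z23) => //; split=> //.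
- by apply: a; rewrite // eq_sym.
- by apply: a; rewrite // eq_sym.
- by apply: b; rewrite // eq_sym.
- by apply: b; rewrite // eq_sym.
- by apply: d; rewrite // eq_sym.
- by apply: d; rewrite // eq_sym.
Qed.

Lemma resolvable_good X Y : X \in D -> Y \in D -> X != Y -> good_pair X Y ->
  resolvable (f X) (f Y).
Proof.
move=> XD YD XY gXY; apply: (@mincomodule_resolvable X Y); rewrite ?minD ?fD ?dD //.
- exact: good_setU.
- by move=> _; apply: good_setC.
- by move=> _; apply: good_setC; rewrite // 1?eq_sym // goodC.
Qed.

(** Each of [x], [y], [w] would be a source or a sink among the three, but there is at most one of
    each. *)
Lemma three_sets X Y W x y w : [disjoint X & Y] -> [disjoint X & W] -> [disjoint Y & W] ->
  x \in X -> y \in Y -> w \in W ->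
  is_module A (X :|: Y) -> is_module A (X :|: W) -> is_module A (Y :|: W) -> False.
Proof.
move=> dXY dXW dYW xX yY wW mXY mXW mYW.
have xY := disjointFr dXY xX; have xW := disjointFr dXW xX.
have yX := disjointFl dXY yY; have yW := disjointFr dYW yY.
have wX := disjointFl dXW wW; have wY := disjointFl dYW wW.
have := @module_arc _ A _ w x y mXY; rewrite !inE wX wY xX yY orbT => /(_ isT isT isT).
have := @module_arc _ A _ y x w mXW; rewrite !inE yX yW xX wW orbT => /(_ isT isT isT).
have := @module_arc _ A _ x y w mYW; rewrite !inE xY xW yY wW orbT => /(_ isT isT isT).
have yx := notin_neq (negbT yX) xX; have wx := notin_neq (negbT wX) xX.
have wy := notin_neq (negbT wY) yY.
rewrite (arcC hA yx) (arcC hA wx) (arcC hA wy).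
by case: ((x, y) \in A); case: ((x, w) \in A); case: ((y, w) \in A).
Qed.

(** The count in [exists_good_pair] wants a fourth point. Instead, a [cotype] member can be paired
    with one of the two others; without such a member, [three_sets] forbids all three unions from
    being modules. *)
Lemma resolvable_triple : #|D| = 3 ->
  exists X Y, [/\ X \in D, Y \in D, X != Y & resolvable (f X) (f Y)].
Proof.
move=> D3; case: (pickP [pred X in D | cotype X]) => [X /andP[/= XD cX]|nco].
  have minX := minD XD; have [ntN nmX] := andP cX.
  have ntD Y : Y \in D -> Y != X -> [/\ nontrivial_module A Y, Y \subset ~: X & 1 < #|Y|].
    move=> YD YX; have dYX := dD YD XD YX.
    have ntY : nontrivial_module A Y.
      case/orP: (mincomodule_comodule (minD YD)) => //.
      move/(nontrivial_module_sub_setC hA minX ntN nmX).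
      by rewrite setCS => /subsetP/(_ _ (fD XD)); rewrite (disjointFl dYX) ?fD.
    split=> //; first by rewrite -disjoints_subset.
    by move: ntY; rewrite nontrivial_moduleE => /and3P[].
  have : #|D :\ X| == 2 by move: D3; rewrite (cardsD1 X) XD add1n => -[->].
  case/cards2P=> Y [W [YW eD]].
  have /setD1P[YX YD] : Y \in D :\ X by rewrite eD !inE eqxx.
  have /setD1P[WX WD] : W \in D :\ X by rewrite eD !inE eqxx orbT.
  have fin U : U \in D -> U != X -> ~~ nontrivial_module A (~: X :\ f U) ->
      exists X Y, [/\ X \in D, Y \in D, X != Y & resolvable (f X) (f Y)].
    move=> UD UX ntNU; exists X, U; rewrite eq_sym; split=> //.
    by apply: (resolvable_cotype minX cX) => //; [apply: fD | apply: fND].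
  case: (boolP (nontrivial_module A (~: X :\ f Y))) => ntY; last exact: (fin Y).
  case: (boolP (nontrivial_module A (~: X :\ f W))) => ntW; last exact: (fin W).
  (* [K] contains no chosen point but still a second point of [Y] and one of [W], so it would be a
     comodule missed by the transversal. *)
  pose K := (~: X :\ f Y) :&: (~: X :\ f W).
  have [_ sYX gtY] := ntD Y YD YX; have [_ sWX gtW] := ntD W WD WX.
  have [y yY yf] := exists_other (f Y) gtY; have [w wW wf] := exists_other (f W) gtW.
  have dYW := dD YD WD YW.
  have yK : y \in K.
    have := subsetP sYX y yY; rewrite !inE yf => -> /=; rewrite andbT.
    by rewrite eq_sym (notin_neq _ yY) // fND // eq_sym.
  have wK : w \in K.
    have := subsetP sWX w wW; rewrite !inE wf => -> /=; rewrite !andbT.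
    by rewrite eq_sym (notin_neq _ wW) // fND.
  have ntK : nontrivial_module A K.
    rewrite nontrivial_moduleE; apply/and3P; split.
    - by apply: module_setI; [move/andP: ntY => []|move/andP: ntW => []].
    - apply: (card_gt1_other wK yK); apply: contraTneq wW => <-.
      by rewrite (disjointFr dYW yY).
    - by apply: (@neq_setT _ _ (f X)); rewrite !inE fD // !andbF.
  have [U UD] := hitD (nontrivial_comodule ntK).
  have [->|UX] := eqVneq U X; first by rewrite !inE fD // !andbF.
  have : U \in D :\ X by rewrite !inE UX.
  by rewrite eD !inE => /orP[]/eqP->; rewrite eqxx ?andbF.
have /card_gt2P[X [Y [W [[XD YD WD] [XY YW WX]]]]] : 2 < #|D| by rewrite D3.
have XW : X != W by rewrite eq_sym.
have fin P Q : P \in D -> Q \in D -> P != Q -> ~~ nontrivial_module A (P :|: Q) ->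
    exists X Y, [/\ X \in D, Y \in D, X != Y & resolvable (f X) (f Y)].
  move=> PD QD PQ ntPQ; exists P, Q; split=> //.
  apply: (@mincomodule_resolvable P Q); rewrite ?minD ?fD ?dD // => cPQ.
    by move: (nco P); rewrite /= PD cPQ.
  by move: (nco Q); rewrite /= QD cPQ.
case: (boolP (nontrivial_module A (X :|: Y))) => ntXY; last exact: (fin X Y).
case: (boolP (nontrivial_module A (X :|: W))) => ntXW; last exact: (fin X W).
case: (boolP (nontrivial_module A (Y :|: W))) => ntYW; last exact: (fin Y W).
have [mXY _] := andP ntXY; have [mXW _] := andP ntXW; have [mYW _] := andP ntYW.
by case: (three_sets (dD XD YD XY) (dD XD WD XW) (dD YD WD YW)
  (fD XD) (fD YD) (fD WD) mXY mXW mYW).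
Qed.

(** A surviving comodule contains both [f X] and [f Y] or neither; if both, goodness gives it a
    third chosen point. So the other chosen points hit it. *)
Lemma flip_Delta_good X Y p q : X \in D -> Y \in D -> X != Y -> good_pair X Y -> tame A p q ->
  (forall Z, comodule A Z -> (p \in Z) = (q \in Z) -> (f X \in Z) = (f Y \in Z)) ->
  Delta (flip A p q) <= #|D| - 2.
Proof.
move=> XD YD XY /forallP gXY tpq pqXY.
have -> : #|D| - 2 = #|D :\ X :\ Y|.
  by rewrite (cardsD1 X D) XD (cardsD1 Y (D :\ X)) !inE YD eq_sym XY !add1n !subSS subn0.
apply: leq_trans (leq_imset_card f _); apply: Delta_leq => Z /(tame_comodule tpq)[cZ e].
have eZ := pqXY Z cZ e.
suff [W [WD WX WY WZ]] : exists W, [/\ W \in D, W != X, W != Y & f W \in Z].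
  by exists (f W) => //; rewrite imset_f // !inE WX WY WD.
have both : f X \in Z -> exists W, [/\ W \in D, W != X, W != Y & f W \in Z].
  move=> XZ; have := gXY Z; rewrite cZ -eZ XZ /=.
  by case/existsP=> W /and4P[? ? ? ?]; exists W.
have [W WD WZ] := hitD cZ.
have [eW|WX] := eqVneq W X; first by apply: both; rewrite -eW.
have [eW|WY] := eqVneq W Y; first by apply: both; rewrite eZ -eW.
by exists W.
Qed.

(** Without goodness only [f Y] is dropped: a surviving comodule containing it also contains
    [f X]. *)
Lemma flip_Delta X Y p q : X \in D -> Y \in D -> X != Y -> tame A p q ->
  (forall Z, comodule A Z -> (p \in Z) = (q \in Z) -> (f X \in Z) = (f Y \in Z)) ->
  Delta (flip A p q) <= #|D|.-1.
Proof.
move=> XD YD XY tpq pqXY; have -> : #|D|.-1 = #|D :\ Y| by rewrite (cardsD1 Y D) YD.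
apply: leq_trans (leq_imset_card f _); apply: Delta_leq => Z /(tame_comodule tpq)[cZ e].
have eZ := pqXY Z cZ e; have [W WD WZ] := hitD cZ.
have [eW|WY] := eqVneq W Y.
  by exists (f X); [rewrite imset_f // !inE XY XD | rewrite eZ -eW].
by exists (f W); rewrite // imset_f // !inE WY WD.
Qed.

End Step.

(** * Upper bound by successive reversals *)

Lemma exists_flip (V : finType) (A : {set V * V}) : tournament A -> 5 <= #|V| ->
  0 < Delta A ->
  exists p q, [/\ p != q & uphalf (Delta (flip A p q)) < uphalf (Delta A)].
Proof.
move=> hA hV; have V0 : 0 < #|V| by apply: leq_trans hV.
have [D [f [minD tiD <- fD hitD]]] := mincomodule_transversal hA V0.
move=> /card_gt0P[X0 X0D].
(* The complement of [X0] is a comodule, so a second member is needed to hit it. *)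
have gtD : 1 < #|D|.
  have [|Y YD fY] := hitD (~: X0); first by rewrite comoduleC (mincomodule_comodule (minD _ X0D)).
  apply/card_gt1P; exists X0, Y; split=> //; apply: contraTneq fY => <-.
  by rewrite inE negbK fD.
have [D3|D3] := eqVneq #|D| 3.
  have [X [Y [XD YD XY [p [q [pq tpq H]]]]]] := resolvable_triple hA hV minD tiD fD hitD D3.
  exists p, q; split=> //; have := flip_Delta hitD XD YD XY tpq H.
  (* [uphalf 3] is 2 and [uphalf 2] is 1, so losing one comodule suffices. *)
  by rewrite D3 => /uphalf_leq.
have [X [Y [XD YD XY gXY]]] := exists_good_pair hA hitD D3 gtD.
have [p [q [pq tpq H]]] := resolvable_good hA hV minD tiD fD XD YD XY gXY.
exists p, q; split=> //; have := flip_Delta_good hitD XD YD XY gXY tpq H.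
move/uphalf_leq/leq_ltn_trans; apply.
by move: gtD; case: #|D| => [|[|d]] // _; rewrite subSS subSS subn0.
Qed.

Lemma exists_indecomposable (V : finType) (A : {set V * V}) n :
  tournament A -> 5 <= #|V| -> uphalf (Delta A) <= n ->
  exists A', [/\ tournament A', #|A :\: A'| <= n & indecomposable A'].
Proof.
move=> hA hV; elim: n A hA => [|n IHn] A hA leD.
all: have [D0|D0] := posnP (Delta A).
(* If [Delta A] is zero, [A] itself serves, in the base case and in the inductive step: a nontrivial
   module alone would form a decomposition of size one. *)
1,3: exists A; split; rewrite // ?setDv ?cards0 //;
  apply/forallP=> M; apply/implyP=> mM; apply: contraT => ntM;
  have : #|[set M]| <= Delta A;
    [ apply: leq_Delta; apply/andP; split;
      [ by apply/forall_inP=> _ /set1P->; apply: nontrivial_comodule; rewrite /nontrivial_module mM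
      | by apply/trivIsetP=> _ _ /set1P-> /set1P->; rewrite eqxx ]
    | by rewrite cards1 D0 ].
- by move: leD D0; case: (Delta A).
have [p [q [pq ltD]]] := exists_flip hA hV D0.
have [|A' [tA' cA' iA']] := IHn (flip A p q) (flip_tournament hA pq).
  by rewrite -ltnS (leq_trans ltD).
exists A'; split=> //.
have sub : A :\: A' \subset (A :\: flip A p q) :|: (flip A p q :\: A').
  apply/subsetP=> r; rewrite [r \in A :\: A']inE => /andP[rA' rA].
  by rewrite in_setU !in_setD rA rA' andbT orNb.
apply: leq_trans (subset_leq_card sub) _; apply: leq_trans (leq_card_setU _ _) _.
by rewrite -add1n leq_add // card_flip.
Qed.

Lemma Inv_setD (V : finType) (A A' : {set V * V}) : tournament A -> tournament A' ->
  Inv A (A :\: A') = A'.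
Proof.
move=> hA hA'; apply/setP=> -[u v]; rewrite !inE negb_and negbK.
have -> : ((u, v) \in [set (p.2, p.1) | p in A :\: A']) = ((v, u) \in A :\: A').
  apply/imsetP/idP => [[[p q] pq [-> ->]] // | vu].
  by exists (v, u).
rewrite inE; have [->|uv] := eqVneq u v.
  by rewrite (negbTE (hA.1 v)) (negbTE (hA'.1 v)).
rewrite (arcC hA' uv) (arcC hA uv) negbK.
by case: ((v, u) \in A); case: ((v, u) \in A').
Qed.

(** * Lower bound from the endpoints of the reversed arcs *)

Lemma leq_uphalf_Delta (V : finType) (A B : {set V * V}) :
  indecomposable (Inv A B) -> uphalf (Delta A) <= #|B|.
Proof.
move=> /forallP indec; rewrite leq_uphalf_double -addnn.
(* There are at most two endpoints per reversed arc, and they will be shown to hit every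
   comodule. *)
pose E := [set p.1 | p in B] :|: [set p.2 | p in B].
have cE : #|E| <= #|B| + #|B|.
  by apply: leq_trans (leq_card_setU _ _) _; rewrite leq_add // leq_imset_card.
apply: leq_trans cE; apply: Delta_leq => Z cZ.
case: (set_0Vmem (E :&: Z)) => [E0|[r /setIP[rE rZ]]]; last by exists r.
have EZ v : v \in Z -> v \notin E.
  by move=> vZ; apply: contra_eqN E0 => vE; apply/set0Pn; exists v; rewrite inE vE.
(* An arc between [Z] and its complement has an end in [Z], hence outside [E], so it is not
   reversed; this serves [Z] and [~: Z] at once. *)
have keep M v x : (M == Z) || (M == ~: Z) -> v \notin M -> x \in M ->
    ((v, x) \in Inv A B) = ((v, x) \in A).
  move=> MZ vM xM.
  have notE : (v \notin E) || (x \notin E).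
    case/orP: MZ => /eqP eM; rewrite eM in vM xM; first by rewrite (EZ x xM) orbT.
    by rewrite EZ //; move: vM; rewrite inE negbK.
  have nB : (v, x) \notin B.
    apply: contraL notE => vx; rewrite negb_or !negbK !inE.
    by rewrite (imset_f fst vx) (imset_f snd vx) orbT.
  have nB' : (x, v) \notin B.
    apply: contraL notE => xv; rewrite negb_or !negbK !inE.
    by rewrite (imset_f fst xv) (imset_f snd xv) orbT.
  rewrite !inE nB /=; have [//|_] := boolP ((v, x) \in A).
  by apply/imsetP=> -[[p q] pq [ev ex]]; move: nB'; rewrite ev ex pq.
have absurd M : (M == Z) || (M == ~: Z) -> nontrivial_module A M -> False.
  move=> MZ /andP[/moduleP mM ntM]; have := indec M; rewrite (negbTE ntM) implybF.
  by case/negP; apply/moduleP=> v x y vM xM yM; rewrite !(keep M) //; apply: mM.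
by case/orP: cZ => /absurd[]; rewrite eqxx ?orbT.
Qed.

Theorem theorem4 (V : finType) (A : {set V * V}) (hA : tournament A)
    (hV : 5 <= #|V|) :
  is_delta A (uphalf (Delta A)).
Proof.
split=> [|B _]; last exact: leq_uphalf_Delta.
have [A' [hA' cA' iA']] := exists_indecomposable hA hV (leqnn _).
have iInv : indecomposable (Inv A (A :\: A')) by rewrite Inv_setD.
exists (A :\: A'); split=> //; first exact: subsetDl.
by apply/eqP; rewrite eqn_leq cA' leq_uphalf_Delta.
Qed.
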